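(* Let $d \geq 2$, let $\mathbb{F}$ be a fixed field, and let $c_d$ be the unique positive solution of $g_d(x)=d+1$, where $g_d(x)=(d+1)(x+1)e^{-x}+x(1-e^{-x})^{d+1}$. Then for every fixed $c>c_d$, $$\lim_{n\to\infty}\Pr\big[Y\in Y_d(n,\tfrac{c}{n}) : H_d(Y;\mathbb{F})\neq 0\big]=1.$$
   Context: $\Delta_{n-1}$ denotes the $(n-1)$-dimensional simplex on vertex set $[n]$, and $\Delta_{n-1}^{(i)}$ its $i$-dimensional skeleton. For $d\ge 2$ and $0\le p\le 1$, $Y_d(n,p)$ is the probability space of simplicial complexes $Y$ with $\Delta_{n-1}^{(d-1)}\subset Y\subset \Delta_{n-1}^{(d)}$, in which each $d$-simplex of $\Delta_{n-1}$ is included independently with probability $p$ (i.e. $\Pr(Y)=p^{f_d(Y)}(1-p)^{\binom{n}{d+1}-f_d(Y)}$, where $f_d(Y)$ is the number of $d$-simplices of $Y$). $H_d(Y;\mathbb{F})$ is the $d$-th homology group of $Y$ with coefficients in $\mathbb{F}$. *)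

(* Defs.v *)
From HB Require Import structures.
From mathcomp Require Import all_boot all_order all_algebra.
From mathcomp Require Import all_classical all_reals all_analysis.
Set Implicit Arguments. Unset Strict Implicit. Unset Printing Implicit Defensive.
Import Order.TTheory GRing.Theory Num.Theory.
Local Open Scope ring_scope.

(* Simplices of Delta_{n-1} on vertex set 'I_n are nonempty subsets of 'I_n;
   a k-simplex is a set of k+1 vertices. *)
Definition faces (n k : nat) : {set {set 'I_n}} := [set s : {set 'I_n} | #|s| == k.+1].

Definition chain (F : fieldType) (n : nat) := {ffun {set 'I_n} -> F}.

Definition supported (F : fieldType) n (K : {set {set 'I_n}}) (k : nat)
  (z : chain F n) : Prop :=
  forall s, z s != 0 -> s \in K /\ #|s| = k.+1.

(* Simplicial boundary with the standard orientation (vertices in increasing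
   order): the coefficient of t in  d(v |: t)  (v \notin t) is
   (-1)^(number of vertices of t smaller than v). *)
Definition boundary (F : fieldType) n (z : chain F n) : chain F n :=
  [ffun t : {set 'I_n} =>
     \sum_(v : 'I_n | v \notin t)
        (-1) ^+ #|[set u in t | (u < v)%N]| * z (v |: t)].

Definition homology_nonzero (F : fieldType) n (K : {set {set 'I_n}}) (k : nat)
  : Prop :=
  exists z : chain F n,
    [/\ supported K k z, boundary z = 0 &
        ~ exists w : chain F n, supported K k.+1 w /\ boundary w = z].

(* The complex  Delta^{(d-1)}_{n-1} union S  for a set S of d-simplices. *)
Definition Ycomplex (n d : nat) (S : {set {set 'I_n}}) : {set {set 'I_n}} :=
  [set s : {set 'I_n} | (0 < #|s| <= d)%N] :|: S.

Definition prob_Hd_nonzero (F : fieldType) (R : realType) (d n : nat) (p : R)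
  : R :=
  \sum_(S in powerset (faces n d))
     (p ^+ #|S| * (1 - p) ^+ (#|faces n d| - #|S|)%N) *
     (if `[< homology_nonzero F (Ycomplex d S) d >] then 1 else 0).

Definition g (R : realType) (d : nat) (x : R) : R :=
  d.+1%:R * (x + 1) * expR (- x) + x * (1 - expR (- x)) ^+ d.+1.

(* Main.v *)
Require Import Defs.
From HB Require Import structures.
From mathcomp Require Import all_boot all_order all_algebra.
From mathcomp Require Import all_classical all_reals all_analysis.
(* fintype and finset come last because classical_sets shadows their names. *)
From mathcomp Require Import ring lra zify fintype finset.
Set Implicit Arguments.
Unset Strict Implicit.
Unset Printing Implicit Defensive.
Import Order.TTheory GRing.Theory Num.Theory.
Import numFieldNormedType.Exports.

(* Call a (d-1)-face heavy if at least two d-faces of Y contain it, and let the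
   core of Y consist of the d-faces all of whose facets are heavy. The boundary
   of a chain supported on the core is supported on heavy faces, so a nonzero
   d-cycle exists as soon as X := #core - #heavy is positive.

   With p = c/n, the degree of a (d-1)-face is asymptotically Poisson(c), whence
   E[X] ~ 'C(n, d) (c (1 - e^-c)^(d+1) / (d+1) - (1 - (1+c) e^-c))
        = 'C(n, d) (g_d(c) - (d+1)) / (d+1),
   which is positive for c > c_d by the intermediate value theorem. Adding one
   d-face changes X by at most d+2, so the Efron-Stein inequality gives
   Var X = O(n^d), and Chebyshev's inequality concludes. *)

Local Open Scope ring_scope.

(** * Expectation over a random subset of [E] whose elements are kept independently with probability
    [p] *)

Definition expect (R : realFieldType) (T : finType) (p : R) (E : {set T})
  (f : {set T} -> R) : R :=
  \sum_(S in powerset E) p ^+ #|S| * (1 - p) ^+ (#|E| - #|S|) * f S.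

Section Expect.
Variables (R : realFieldType) (T : finType) (p : R).
Implicit Types (E A B C S : {set T}) (f h : {set T} -> R).

Lemma expect0 f : expect p set0 f = f set0.
Proof. by rewrite /expect powerset0 big_set1 cards0 !expr0 !mul1r. Qed.

(** Splits the subsets of [x |: E] according to whether they contain [x]. The inductions on the
    ground set below rest on this conditioning on one element. *)
Lemma expectU1 E x f : x \notin E ->
  expect p (x |: E) f =
  p * expect p E (fun S => f (x |: S)) + (1 - p) * expect p E f.
Proof.
move=> xE; rewrite /expect (bigID (fun S : {set T} => x \in S)) /=; congr (_ + _).
  rewrite (reindex_onto (fun S => x |: S) (fun S => S :\ x)) /=; last first.
    by move=> S /andP[_ xS]; rewrite setD1K.
  rewrite big_distrr /=; apply: eq_big => [S|S]; last first.
    move=> /andP[/andP[_ _] /eqP eS].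
    have xS : x \notin S by rewrite -eS !inE eqxx.
    by rewrite !cardsU1 xE xS !add1n subSS exprS !mulrA.
  rewrite !powersetE !inE eqxx andbT.
  have [xS|xS] := boolP (x \in S).
    have -> : ((x |: S) :\ x == S) = false.
      by apply/eqP => eS; move: xS; rewrite -eS !inE eqxx.
    rewrite andbF; apply/esym/negP => /subsetP /(_ _ xS); exact/negP.
  rewrite setU1K // eqxx andbT; apply/idP/idP => [/subsetP sS|]; last exact: setUS.
  apply/subsetP => y yS; have /sS : y \in x |: S by rewrite !inE yS orbT.
  by rewrite !inE => /orP[/eqP yx|//]; rewrite -yx yS in xS.
rewrite big_distrr /=; apply: eq_big => [S|S].
  rewrite !powersetE; apply/andP/idP => [[/subsetP sS xS]|sS].
    apply/subsetP => y yS; move: (sS _ yS); rewrite !inE => /orP[/eqP yx|//].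
    by rewrite -yx yS in xS.
  split; first exact: (subset_trans sS (subsetUr _ _)).
  by apply: contra xE; apply/subsetP.
move=> /andP[]; rewrite powersetE => sS xS.
have sSE : S \subset E.
  apply/subsetP => y yS; move/subsetP: sS => /(_ _ yS); rewrite !inE.
  by case/orP => [/eqP yx|//]; rewrite -yx yS in xS.
rewrite cardsU1 xE add1n subSn ?subset_leq_card // exprS; ring.
Qed.

Lemma eq_expect E f h :
  (forall S, S \subset E -> f S = h S) -> expect p E f = expect p E h.
Proof. by move=> fh; apply: eq_bigr => S; rewrite powersetE => /fh ->. Qed.

Lemma expectD E f h :
  expect p E (fun S => f S + h S) = expect p E f + expect p E h.
Proof. by rewrite /expect -big_split; apply: eq_bigr => S _; rewrite mulrDr. Qed.

Lemma expectZ E a f : expect p E (fun S => a * f S) = a * expect p E f.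
Proof. by rewrite /expect big_distrr; apply: eq_bigr => S _; rewrite /= mulrCA. Qed.

Lemma expectB E f h :
  expect p E (fun S => f S - h S) = expect p E f - expect p E h.
Proof.
by rewrite -mulN1r -expectZ -expectD; apply: eq_expect => S _; rewrite mulN1r.
Qed.

Lemma expect_sum (I : finType) (P : pred I) E (f : I -> {set T} -> R) :
  expect p E (fun S => \sum_(i | P i) f i S) = \sum_(i | P i) expect p E (f i).
Proof.
by rewrite /expect exchange_big; apply: eq_bigr => S _; rewrite /= big_distrr.
Qed.

Lemma set_ind (P : {set T} -> Prop) : P set0 ->
  (forall x A, x \notin A -> P A -> P (x |: A)) -> forall A, P A.
Proof.
move=> P0 PU A; have [n] := ubnP #|A|; elim: n A => // n IHn A leA.
have [->//|[x xA]] := set_0Vmem A.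
rewrite -(setD1K xA); apply: PU; first by rewrite !inE eqxx.
by apply: IHn; move: leA; rewrite (cardsD1 x) xA.
Qed.

Lemma expect_cst E a : expect p E (fun=> a) = a.
Proof.
elim/set_ind: E => [|x E xE IH]; first by rewrite expect0.
by rewrite expectU1 // IH; ring.
Qed.

(** Independence: the indicator is a product over [E] of factors that each look at a single element,
    so its expectation is the product of theirs. *)
Lemma expect_cylinder E A C : A \subset E -> C \subset E -> [disjoint A & C] ->
  expect p E (fun S => ((A \subset S) && [disjoint C & S])%:R) =
  p ^+ #|A| * (1 - p) ^+ #|C|.
Proof.
pose h (D : {set T}) := \prod_(x in D) (if x \in A then p else if x \in C then 1 - p else 1).
pose k (D S : {set T}) : R :=
  \prod_(x in D) (((x \in A) ==> (x \in S)) && ((x \in C) ==> (x \notin S)))%:R.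
move=> AE CE disjAC; have dAC x : x \in A -> x \in C = false.
  by move=> xA; apply/negbTE; rewrite (disjointFr disjAC).
(* The induction runs on an auxiliary set [D] with [A] and [C] fixed, since they need not stay
   inside a shrinking [E]; afterwards [D] is taken to be [E]. *)
have kh D : expect p D (k D) = h D.
  elim/set_ind: D => [|x D xD IH]; first by rewrite expect0 /k /h !big_set0.
  rewrite expectU1 // /h big_setU1 //= -/(h D) -IH.
  set a := fun S => _.
  rewrite (eq_expect (f := a) (h := fun S => (x \notin C)%:R * k D S)).
    rewrite (eq_expect (f := k (x |: D)) (h := fun S => (x \notin A)%:R * k D S)).
      rewrite !expectZ; case: (boolP (x \in A)) => [/dAC ->/=|_]; first by ring.
      by case: (x \in C) => /=; ring.
    move=> S sS; rewrite /k big_setU1 //=; congr (_ * _).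
    have /negbTE -> : x \notin S by apply: contra xD; apply/subsetP.
    by rewrite implybT andbT implybF.
  move=> S sS; rewrite /a /k big_setU1 //= !inE eqxx /= implybT implybF.
  congr (_ * _); apply: eq_bigr => y yD; rewrite !inE.
  by have /negbTE -> : y != x by apply: contraNneq xD => <-.
have hE : h E = p ^+ #|A| * (1 - p) ^+ #|C|.
  rewrite /h (bigID (mem A)) /=; congr (_ * _).
    rewrite -prodr_const; apply: eq_big => x.
      by apply/andP/idP => [[]//|xA]; split => //; exact: (subsetP AE).
    by case/andP => _ ->.
  rewrite (bigID (mem C)) /= [X in _ * X]big1 ?mulr1; last first.
    by move=> x /andP[/andP[_ /negbTE ->] /negbTE ->].
  rewrite -prodr_const; apply: eq_big => x.
    apply/andP/idP => [[]//|xC]; split => //; rewrite (subsetP CE) //=.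
    by apply/negP => /dAC; rewrite xC.
  by case/andP => /andP[_ /negbTE ->] ->.
rewrite -hE -kh; apply: eq_expect => S sS; rewrite /k.
case: (boolP (_ && _)) => [/andP[AS CS]|].
  rewrite big1 // => x _; apply/eqP; rewrite pnatr_eq1 eqb1.
  apply/andP; split; apply/implyP => xAC; first exact: (subsetP AS).
  by rewrite (disjointFr CS xAC).
rewrite negb_and => nAC; apply/esym/eqP/prodf_eq0.
case/orP: nAC => [/subsetPn[x xA xS]|].
  by exists x; rewrite ?(subsetP AE)//= xA (negbTE xS).
rewrite -setI_eq0 => /set0Pn[x]; rewrite inE => /andP[xC xS].
by exists x; rewrite ?(subsetP CE)//= xC xS andbF.
Qed.

Lemma disjointsU A B C :
  [disjoint A :|: B & C] = [disjoint A & C] && [disjoint B & C].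
Proof. by rewrite !disjoints_subset subUset. Qed.

(* By induction on [J], writing [1_{B i meets S} = 1 - 1_{B i avoids S}]. *)
Lemma expect_hit (I : eqType) (J : seq I) (B : I -> {set T}) E A C :
  uniq J -> A \subset E -> C \subset E -> [disjoint A & C] ->
  (forall i, i \in J -> [/\ B i \subset E, [disjoint A & B i] & [disjoint C & B i]]) ->
  (forall i j, i \in J -> j \in J -> i != j -> [disjoint B i & B j]) ->
  expect p E (fun S => ((A \subset S) && [disjoint C & S])%:R *
      \prod_(i <- J) (~~ [disjoint B i & S])%:R) =
  p ^+ #|A| * (1 - p) ^+ #|C| * \prod_(i <- J) (1 - (1 - p) ^+ #|B i|).
Proof.
elim: J C => [|i J IH] C /=.
  move=> _ AE CE disjAC _ _; rewrite big_nil mulr1 -(expect_cylinder AE CE disjAC).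
  by apply: eq_expect => S _; rewrite big_nil mulr1.
case/andP => iJ uJ AE CE disjAC HB BB.
have [BiE ABi CBi] := HB i (mem_head _ _).
rewrite big_cons.
have -> : p ^+ #|A| * (1 - p) ^+ #|C| *
   ((1 - (1 - p) ^+ #|B i|) * \prod_(j <- J) (1 - (1 - p) ^+ #|B j|)) =
   p ^+ #|A| * (1 - p) ^+ #|C| * (\prod_(j <- J) (1 - (1 - p) ^+ #|B j|)) -
   p ^+ #|A| * (1 - p) ^+ #|C :|: B i| * (\prod_(j <- J) (1 - (1 - p) ^+ #|B j|)).
  by rewrite cardsU (disjoint_setI0 CBi) cards0 subn0 exprD; ring.
rewrite -!IH //.
- rewrite -expectB; apply: eq_expect => S _; rewrite big_cons mulrA -mulrBl.
  congr (_ * _); rewrite disjointsU.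
  by case: (A \subset S); case: [disjoint C & S]; case: [disjoint B i & S];
    rewrite /= ?(mulr0,mulr1,subr0,subrr,mul0r).
- by rewrite subUset CE BiE.
- by rewrite disjoint_sym disjointsU !(disjoint_sym _ A) disjAC ABi.
- move=> j jJ; have [BjE ABj CBj] := HB j (mem_behead (s := i :: J) jJ).
  split => //; rewrite disjointsU CBj /=; apply: BB; rewrite ?mem_head ?inE ?jJ ?orbT //.
  by apply: contraNneq iJ => ->.
- by move=> j k jJ kJ; apply: BB; rewrite inE ?jJ ?kJ orbT.
- by move=> j jJ; apply: HB; rewrite inE jJ orbT.
- by move=> j k jJ kJ; apply: BB; rewrite inE ?jJ ?kJ orbT.
Qed.

(** Removes the cases of no common point and of exactly one. The summand at [x] tests whether
    [B :&: S] is [[set x]], so the sum is 1 for a singleton and 0 otherwise. *)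
Lemma ge2_cardI B S : (2 <= #|B :&: S|)%:R =
  1 - ([disjoint B & S])%:R -
  \sum_(x in B) (([set x] \subset S) && [disjoint B :\ x & S])%:R :> R.
Proof.
have sum0 : #|B :&: S| != 1 ->
    \sum_(x in B) (([set x] \subset S) && [disjoint B :\ x & S])%:R = 0 :> R.
  move=> n1; apply: big1 => x xB; case: andP => // -[]; rewrite sub1set => xS.
  rewrite -setI_eq0 => /eqP dBS; case/eqP: n1; apply/eqP/cards1P; exists x.
  apply/setP => y; rewrite !inE; apply/andP/eqP => [[yB yS]|->//].
  apply: contraTeq isT => yx; move/setP: dBS => /(_ y).
  by rewrite !inE yx yB yS.
case: (ltngtP #|B :&: S| 1) => [|lt1|/eqP/cards1P[x BSx]].
- rewrite ltnS leqn0 => c0; rewrite sum0 ?(eqP c0) //.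
  by rewrite -setI_eq0 -cards_eq0 c0 subrr subr0.
- rewrite sum0; last by rewrite neq_ltn lt1 orbT.
  rewrite -setI_eq0 -cards_eq0; have -> : (#|B :&: S| == 0) = false by lia.
  by rewrite !subr0.
- have xBS : x \in B :&: S by rewrite BSx inE.
  have /andP[xB xS] : (x \in B) && (x \in S) by rewrite -in_setI.
  rewrite -setI_eq0 BSx.
  have -> : ([set x] == set0) = false by apply/eqP => /setP/(_ x); rewrite !inE eqxx.
  rewrite (bigD1 x) //= sub1set xS -setI_eq0.
  have -> : (B :\ x) :&: S == set0 by rewrite setIDAC BSx setDv.
  rewrite big1 ?addr0 ?subr0 ?subrr // => y /andP[yB yx]; rewrite sub1set.
  case: (boolP (y \in S)) => // yS; have : y \in B :&: S by rewrite inE yB.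
  by rewrite BSx inE (negbTE yx).
Qed.

(** A binomial tail: one minus the probabilities of the values 0 and 1. For empty [B] the factor
    [#|B|%:R] kills the term in which [.-1] truncates. *)
Lemma expect_ge2_cardI E B : B \subset E ->
  expect p E (fun S => (2 <= #|B :&: S|)%:R) =
  1 - (1 - p) ^+ #|B| - #|B|%:R * (p * (1 - p) ^+ #|B|.-1).
Proof.
move=> BE; under eq_expect do rewrite ge2_cardI.
rewrite !expectB expect_cst expect_sum; congr (_ - _ - _).
  have d0B : [disjoint (set0 : {set T}) & B] by rewrite -setI_eq0 set0I.
  have := expect_cylinder (sub0set E) BE d0B; rewrite cards0 expr0 mul1r => <-.
  by apply: eq_expect => S _; rewrite sub0set.
rewrite mulr_natl -sumr_const; apply: eq_bigr => x xB.
rewrite expect_cylinder.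
- by rewrite cards1 expr1 (cardsD1 x B) xB.
- by rewrite sub1set (subsetP BE).
- by apply: subset_trans BE; exact: subsetDl.
- by rewrite disjoints1 !inE eqxx.
Qed.

Hypothesis p01 : 0 <= p <= 1.

Lemma le_expect E f h :
  (forall S, S \subset E -> f S <= h S) -> expect p E f <= expect p E h.
Proof.
case/andP: p01 => p0 p1 fh; apply: ler_sum => S; rewrite powersetE => /fh.
by apply: ler_wpM2l; rewrite mulr_ge0 // exprn_ge0 // subr_ge0.
Qed.

(* Efron-Stein inequality for functions with bounded differences. *)
Lemma expect_var_le (L : R) E f :
  (forall x S, x \in E -> S \subset E -> x \notin S -> `|f (x |: S) - f S| <= L) ->
  expect p E (fun S => f S ^+ 2) - expect p E f ^+ 2 <= p * L ^+ 2 * #|E|%:R.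
Proof.
case/andP: (p01) => p0 p1.
elim/set_ind: E f => [|x E xE IH] f fL.
  by rewrite !expect0 cards0 mulr0 subrr.
have xS S : S \subset E -> x \notin S by move=> sS; apply: contra xE; apply/subsetP.
have V0 : expect p E (fun S => f S ^+ 2) - expect p E f ^+ 2 <= p * L ^+ 2 * #|E|%:R.
  apply: IH => y S yE sS yS; apply: fL => //; first by rewrite !inE yE orbT.
  exact: (subset_trans sS (subsetUr _ _)).
have V1 : expect p E (fun S => f (x |: S) ^+ 2) - expect p E (fun S => f (x |: S)) ^+ 2
    <= p * L ^+ 2 * #|E|%:R.
  apply: (IH (fun S => f (x |: S))) => y S yE sS yS.
  rewrite setUCA; apply: fL; first by rewrite !inE yE orbT.
    exact: setUS.
  by rewrite !inE negb_or yS andbT; apply: contraNneq xE => <-.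
have fL1 S : S \subset E -> `|f (x |: S) - f S| <= L.
  move=> sS; apply: fL; rewrite ?inE ?eqxx ?xS //.
  exact: (subset_trans sS (subsetUr _ _)).
have D : `|expect p E (fun S => f (x |: S)) - expect p E f| <= L.
  rewrite -expectB ler_norml -{1}(expect_cst E (- L)) -{2}(expect_cst E L).
  by apply/andP; split; apply: le_expect => S /fL1; rewrite ler_norml => /andP[].
rewrite !expectU1 // cardsU1 xE natrD mulrDr mulr1.
move: V0 V1 D.
set a := expect p E (fun S => f (x |: S)); set b := expect p E f.
set a2 := expect p E (fun S => f (x |: S) ^+ 2); set b2 := expect p E (fun S => f S ^+ 2).
set K := p * L ^+ 2 * #|E|%:R => V0 V1 D.
have D2 : (a - b) ^+ 2 <= L ^+ 2.
  by rewrite -real_normK ?num_real // lerXn2r ?nnegrE // (le_trans _ D).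
(* Law of total variance with respect to the presence of [x]: the averaged conditional variances,
   bounded by induction, plus the variance of the conditional mean, bounded through [D2]. *)
have -> : p * a2 + (1 - p) * b2 - (p * a + (1 - p) * b) ^+ 2 =
   p * (a2 - a ^+ 2) + (1 - p) * (b2 - b ^+ 2) + p * ((1 - p) * (a - b) ^+ 2) by ring.
have H1 : p * (a2 - a ^+ 2) <= p * K by apply: ler_wpM2l.
have H2 : (1 - p) * (b2 - b ^+ 2) <= (1 - p) * K by apply: ler_wpM2l; rewrite ?subr_ge0.
have H3 : p * ((1 - p) * (a - b) ^+ 2) <= p * L ^+ 2.
  apply: ler_wpM2l => //; apply: le_trans D2; apply: ler_piMl; rewrite ?sqr_ge0 //.
  by rewrite lerBlDr lerDl.
lra.
Qed.

(** Wherever [f S <= 0], the squared deviation from the positive mean [m] is at least [m ^+ 2]. *)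
Lemma expect_chebyshev E f :
  0 < expect p E f ->
  expect p E (fun S => (f S <= 0)%R%:R) <=
  (expect p E (fun S => f S ^+ 2) - expect p E f ^+ 2) / expect p E f ^+ 2.
Proof.
set m := expect p E f => m0.
rewrite ler_pdivlMr ?exprn_gt0 // mulrC -expectZ.
have -> : expect p E (fun S => f S ^+ 2) - m ^+ 2 =
   expect p E (fun S => f S ^+ 2 - 2 * m * f S + m ^+ 2).
  by rewrite expectD expectB expectZ expect_cst -/m; ring.
apply: le_expect => S _; have -> : f S ^+ 2 - 2 * m * f S + m ^+ 2 = (f S - m) ^+ 2 by ring.
case: (lerP (f S) 0) => f0 /=; last by rewrite mulr0n mulr0 sqr_ge0.
by rewrite mulr1n mulr1; nra.
Qed.

End Expect.

(** * Linear algebra and counting tools *)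

(** A matrix with [#|A|] rows and fewer columns has a nonzero left kernel vector [v]; [z] is [v]
    transported along the enumeration of [A] and extended by zero. *)
Lemma kernel_vector (F : fieldType) (I J : finType) (A : {set I}) (B : {set J})
  (M : I -> J -> F) : (#|B| < #|A|)%N ->
  exists z : {ffun I -> F}, [/\ z != 0, forall i, z i != 0 -> i \in A &
    forall j, j \in B -> \sum_i z i * M i j = 0].
Proof.
move=> ltBA.
pose N := \matrix_(i < #|A|, j < #|B|) M (enum_val i) (enum_val j).
have /rowV0Pn[v /sub_kermxP vN v0] : kermx N != 0.
  by rewrite -mxrank_eq0 mxrank_ker subn_eq0 -ltnNge (leq_ltn_trans (rank_leq_col _)).
pose z := [ffun i : I => \sum_(k < #|A|) v 0 k * (enum_val k == i)%:R].
exists z; split.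
- apply: contraNneq v0 => z0; apply/eqP/rowP => k; rewrite mxE.
  move/ffunP: z0 => /(_ (enum_val k)); rewrite !ffunE (bigD1 k) //= eqxx mulr1.
  rewrite big1 ?addr0 // => l lk; rewrite (inj_eq enum_val_inj) (negbTE lk).
  by rewrite mulr0.
- move=> i; apply: contraNT => iA; rewrite ffunE big1 // => k _.
  have /negbTE -> : enum_val k != i by apply: contraNneq iA => <-; exact: enum_valP.
  by rewrite mulr0.
- move=> j jB; move/rowP: vN => /(_ (enum_rank_in jB j)); rewrite !mxE => vNj.
  rewrite -[RHS]vNj.
  under eq_bigr do rewrite ffunE big_distrl /=.
  rewrite exchange_big; apply: eq_bigr => k _; rewrite mxE enum_rankK_in //.
  rewrite (bigD1 (enum_val k)) //= eqxx mulr1 big1 ?addr0 // => i ik.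
  by rewrite eq_sym (negbTE ik) mulr0 mul0r.
Qed.

Lemma leq_card_bigcup (I T : finType) (P : {set I}) (B : I -> {set T}) (k : nat) :
  (forall i, i \in P -> #|B i| <= k)%N -> (#|\bigcup_(i in P) B i| <= #|P| * k)%N.
Proof.
move=> Bk; rewrite -sum_nat_const; apply: (@leq_trans (\sum_(i in P) #|B i|)).
  elim/big_rec2: _ => [|i m D _ IH]; first by rewrite cards0.
  by rewrite (leq_trans (leq_card_setU _ _)) // leq_add2l.
exact: leq_sum.
Qed.

(** * Heavy faces, the core, and the excess of core faces over heavy faces *)

Section Core.
Variables (n d : nat).
Implicit Types (s t x : {set 'I_n}) (S : {set {set 'I_n}}).

Definition facets s : {set {set 'I_n}} := [set t : {set 'I_n} | t \subset s & #|t| == d].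
(** All candidate d-faces over [t], independently of the random set [S]; the degree of [t] in the
    complex is [#|star t :&: S|]. *)
Definition star t : {set {set 'I_n}} := [set s in faces n d | t \subset s].
Definition heavy S : {set {set 'I_n}} :=
  [set t : {set 'I_n} | (#|t| == d) && (2 <= #|star t :&: S|)%N].
Definition core S : {set {set 'I_n}} := [set s in S | facets s \subset heavy S].

Lemma card_facets s : s \in faces n d -> #|facets s| = d.+1.
Proof. by rewrite inE => /eqP cs; rewrite cards_draws cs binSn. Qed.

(** The d-faces over [t] are the sets [v |: t], one for each vertex [v] outside [t]. *)
Lemma card_star t : #|t| = d -> #|star t| = (n - d)%N.
Proof.
move=> ct; have -> : star t = [set v |: t | v in ~: t].
  apply/setP => s; rewrite !inE; apply/andP/imsetP => [[/eqP cs ts]|[v]].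
    have /eqP/cards1P[v sv] : #|s :\: t| = 1.
      by rewrite cardsD (setIidPr ts) cs ct subSnn.
    have : v \in s :\: t by rewrite sv inE.
    rewrite inE => /andP[vt vs]; exists v; first by rewrite inE.
    apply/setP => y; move/setP: sv => /(_ y); rewrite !inE.
    by have /implyP := subsetP ts y; do 2!case: (y \in _); case: (y == v).
  rewrite inE => vt ->; rewrite cardsU1 vt ct add1n eqxx; split => //.
  exact: subsetUr.
rewrite card_in_imset; first by rewrite cardsCs setCK card_ord ct.
move=> u v.
rewrite !inE => ut vt /setP/(_ u); rewrite !inE eqxx (negbTE ut) !orbF.
by move/esym/eqP.
Qed.

(** Two distinct facets of [s] have union [s], so [s] is the only d-face containing both. This
    provides the disjointness that [expect_hit] asks for. *)
Lemma facets_disjoint_stars s t1 t2 : s \in faces n d ->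
  t1 \in facets s -> t2 \in facets s -> t1 != t2 ->
  [disjoint star t1 :\ s & star t2 :\ s].
Proof.
rewrite !inE => /eqP cs /andP[t1s /eqP c1] /andP[t2s /eqP c2] t12.
have cU : (d < #|t1 :|: t2|)%N.
  rewrite -c1 proper_card // properE subsetUl /=.
  apply: contra t12; rewrite subUset subxx /= => t21.
  by rewrite eq_sym eqEcard t21 c1 c2 leqnn.
have eU (r : {set 'I_n}) : #|r| = d.+1 -> t1 \subset r -> t2 \subset r -> t1 :|: t2 = r.
  by move=> cr t1r t2r; apply/eqP; rewrite eqEcard subUset t1r t2r cr.
rewrite -setI_eq0; apply/eqP/setP => r; rewrite !inE; apply/negP.
case/andP => /and3P[/eqP rs /eqP cr t1r] /and3P[_ _ t2r].
by apply: rs; rewrite -(eU s) ?(eU r).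
Qed.

(** Once [s] lies in [S], it accounts for one of the two d-faces required over each facet, so a
    facet is heavy when one further d-face over it is in [S]. This is the form to which [expect_hit]
    applies. *)
Lemma core_mem s S : s \in faces n d ->
  (s \in core S) = (s \in S) && all (fun t => ~~ [disjoint star t :\ s & S]) (enum (facets s)).
Proof.
move=> sd; rewrite inE; case: (boolP (s \in S)) => //= sS.
apply/subsetP/allP => [H t|H t tf].
  rewrite mem_enum => tf; have := H t tf; rewrite inE => /andP[_].
  have -> : star t :&: S = s |: ((star t :\ s) :&: S).
    apply/setP => r; rewrite !inE; have [->|//] := eqVneq r s.
    by move: tf sd; rewrite !inE => /andP[-> _] ->; rewrite sS.
  by rewrite cardsU1 !inE eqxx /= add1n ltnS -setI_eq0 -card_gt0.
have := H t; rewrite mem_enum => /(_ tf); move: (tf); rewrite !inE => /andP[ts ->] /=.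
rewrite -setI_eq0 -card_gt0 (cardsD1 s (star t :&: S)) => h.
have -> : s \in star t :&: S by rewrite !inE ts sS; move: sd; rewrite inE => ->.
rewrite add1n ltnS; apply: leq_trans h _; apply: subset_leq_card.
by apply/subsetP => r; rewrite !inE -!andbA.
Qed.

(** The boundary conditions at heavy faces are fewer than the coefficients on the core, so a nonzero
    core chain satisfies them all. It is a cycle, and it bounds nothing because the complex has no
    (d+1)-faces. *)
Lemma core_homology (F : fieldType) S : S \subset faces n d ->
  (#|heavy S| < #|core S|)%N -> homology_nonzero F (Ycomplex d S) d.
Proof.
move=> Sd hc.
(* The boundary matrix: [M s t] is the coefficient of [t] in the boundary of [s]. *)
pose M (s t : {set 'I_n}) : F := \sum_(v : 'I_n | v \notin t)
  (-1) ^+ #|[set u in t | (u < v)%N]| * (v |: t == s)%:R.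
have [z [z0 zc zM]] := kernel_vector M hc.
have zS s : z s != 0 -> s \in S by move/zc; rewrite inE => /andP[].
have cardS s : s \in S -> #|s| = d.+1.
  by move=> /(subsetP Sd); rewrite inE => /eqP.
exists z; split.
- by move=> s /zS sS; split; [rewrite !inE sS orbT|exact: cardS].
- apply/ffunP => t; rewrite !ffunE.
  have [th|tnh] := boolP (t \in heavy S).
    rewrite -[RHS](zM t th) /M; under [RHS]eq_bigr do rewrite big_distrr /=.
    rewrite [RHS]exchange_big; apply: eq_bigr => v vt.
    rewrite (bigD1 (v |: t)) //= eqxx mulr1 mulrC big1 ?addr0 // => s sv.
    by rewrite eq_sym (negbTE sv) !mulr0.
  (* Off the heavy faces every term vanishes: a core face [v |: t] would make its facet [t]
     heavy. *)
  apply: big1 => v vt; have [->|] := eqVneq (z (v |: t)) 0; first by rewrite mulr0.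
  move=> /zc; rewrite inE => /andP[/cardS]; rewrite cardsU1 vt add1n => -[ct].
  move=> /subsetP/(_ t); rewrite inE subsetUr ct eqxx => /(_ isT) th.
  by rewrite th in tnh.
(* A chain [w] on (d+1)-faces of the complex is zero, since all faces have at most d+1 vertices;
   then [z] would be zero. *)
- move=> [w [wS wz]]; case/eqP: z0; rewrite -wz; apply/ffunP => t; rewrite !ffunE.
  apply: big1 => v _; have [->|/wS[]] := eqVneq (w (v |: t)) 0; first by rewrite mulr0.
  by rewrite !inE => /orP[/andP[_ le] e|/cardS ->]; lia.
Qed.

(** Both counts grow with [S]. Only the d+1 facets of [x] can become heavy, and at most d+2 faces
    can enter the core, so the difference changes by at most d+2 either way. *)
Lemma core_excess_lipschitz (R : realFieldType) x S :
  x \in faces n d -> S \subset faces n d -> x \notin S ->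
  `| (#|core (x |: S)|%:R - #|heavy (x |: S)|%:R)
     - (#|core S|%:R - #|heavy S|%:R) | <= d.+2%:R :> R.
Proof.
move=> xd Sd xS.
have starU t : star t :&: S \subset star t :&: (x |: S) by rewrite setIS ?subsetUr.
have H1 : heavy S \subset heavy (x |: S).
  apply/subsetP => t; rewrite !inE => /andP[-> le2] /=.
  exact: leq_trans le2 (subset_leq_card _).
have starx t : #|t| = d -> t \notin facets x -> star t :&: (x |: S) = star t :&: S.
  move=> ct; rewrite inE ct eqxx andbT => tx; apply/setP => s; rewrite !inE.
  by have [->|//] := eqVneq s x; rewrite (negbTE tx) andbF.
have H2 : heavy (x |: S) \subset heavy S :|: facets x.
  apply/subsetP => t th; rewrite in_setU; have [//|tx] := boolP (t \in facets x).
    by rewrite orbT.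
  move: th; rewrite !inE => /andP[/eqP ct].
  by rewrite starx // ct eqxx => ->.
have C1 : core S \subset core (x |: S).
  apply/subsetP => s; rewrite !inE => /andP[-> sh]; rewrite orbT /=.
  exact: subset_trans sh H1.
(* A d-face can enter the core only if it is x itself or the unique d-face of S
   containing some facet of x. *)
pose B t := if (#|star t :&: S| <= 1)%N then star t :&: S else set0.
have C2 : core (x |: S) \subset core S :|: (x |: \bigcup_(t in facets x) B t).
  apply/subsetP => s; rewrite !inE => /andP[/orP[->|sS] sh]; first by rewrite orbT.
  rewrite sS /=; have [//|/subsetPn[t ts th]] := boolP (facets s \subset heavy S).
  apply/orP; right; apply/orP; right.
  have := subsetP (subset_trans sh H2) t ts; rewrite in_setU (negbTE th) /= => tx.
  apply/bigcupP; exists t => //; rewrite /B.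
  move: ts th; rewrite !inE => /andP[ts ->] /=; rewrite -ltnNge ltnS => ->.
  by rewrite !inE ts sS; move/subsetP: Sd => /(_ _ sS); rewrite inE => ->.
have le1 := subset_leq_card H1; have le2 := subset_leq_card C1.
have le3 : (#|heavy (x |: S)| <= #|heavy S| + d.+1)%N.
  rewrite -(card_facets xd); apply: leq_trans (subset_leq_card H2) _.
  exact: leq_card_setU.
have le4 : (#|core (x |: S)| <= #|core S| + d.+2)%N.
  apply: leq_trans (subset_leq_card C2) _; apply: leq_trans (leq_card_setU _ _) _.
  rewrite leq_add2l; apply: leq_trans (leq_card_setU _ _) _; rewrite cards1 add1n ltnS.
  rewrite -(card_facets xd) -[leqRHS]muln1; apply: leq_card_bigcup => t _.
  by rewrite /B; case: ifP => // _; rewrite cards0.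
move: le1 le2 le3 le4; rewrite -!(ler_nat R) !natrD -!natr1 ler_norml => *.
apply/andP; split; lra.
Qed.

(** Linearity of expectation over d-faces and over (d-1)-faces. A d-face is in the core when it is
    present and each of its d+1 facets lies in another present d-face, chosen from disjoint sets of
    size n-d-1. *)
Lemma expect_core_excess (R : realFieldType) (p : R) :
  expect p (faces n d) (fun S => #|core S|%:R - #|heavy S|%:R) =
  'C(n, d.+1)%:R * (p * (1 - (1 - p) ^+ (n - d.+1)) ^+ d.+1) -
  'C(n, d)%:R * (1 - (1 - p) ^+ (n - d) - (n - d)%:R * (p * (1 - p) ^+ (n - d.+1))).
Proof.
rewrite expectB; congr (_ - _).
  transitivity (expect p (faces n d) (fun S => \sum_(s in faces n d) (s \in core S)%:R)).
    apply: eq_expect => S Sd; rewrite -natr_sum; congr (_%:R).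
    rewrite -sum1_card (big_setID (faces n d)) /= [X in (_ + X)%N]big1 ?addn0; last first.
      move=> s; rewrite !inE => /andP[sd /andP[/(subsetP Sd)]].
      by rewrite inE (negbTE sd).
    rewrite (eq_bigl (fun s => (s \in faces n d) && (s \in core S))).
      by rewrite big_mkcondr; apply: eq_bigr => s _; case: (s \in core S).
    by move=> s; rewrite in_setI andbC.
  rewrite expect_sum; have -> : 'C(n, d.+1) = #|faces n d|.
    by rewrite card_draws card_ord.
  rewrite mulr_natl -sumr_const; apply: eq_bigr => s sd.
  have card_starD1 : forall t, t \in enum (facets s) -> #|star t :\ s| = (n - d.+1)%N.
    move=> t; rewrite mem_enum inE => /andP[ts /eqP ct].
    rewrite subnS -(card_star ct) (cardsD1 s (star t)).
    by have -> : s \in star t by rewrite inE sd ts.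
  (* Shapes the value for [expect_hit]: [s] is forced in, nothing is forced out, and one set has to
     be hit for each facet. *)
  have -> : p * (1 - (1 - p) ^+ (n - d.+1)) ^+ d.+1 =
      p ^+ #|[set s]| * (1 - p) ^+ #|(set0 : {set {set 'I_n}})| *
      \prod_(t <- enum (facets s)) (1 - (1 - p) ^+ #|star t :\ s|).
    set k := (n - d.+1)%N in card_starD1 *.
    rewrite cards1 cards0 mulr1 -(card_facets sd) -prodr_const big_enum_cond /=.
    congr (_ * _); apply: eq_big => [t|t]; first by rewrite andbT.
    by rewrite -mem_enum => /card_starD1 ->.
  rewrite -(@expect_hit _ _ p _ _ (fun t => star t :\ s) (faces n d)) ?enum_uniq ?sub0set ?sub1set //.
  - apply: eq_expect => S _; rewrite core_mem // sub1set.
    have -> : [disjoint (set0 : {set {set 'I_n}}) & S] by rewrite -setI_eq0 set0I.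
    rewrite andbT -natr_prod -mulnb natrM; congr (_ * _%:R).
    by elim: (enum _) => [|t J IH]; rewrite ?big_nil //= big_cons -mulnb IH.
  - by rewrite disjoint_sym -setI_eq0 set0I.
  - move=> t _; split; first by apply/subsetP => r; rewrite !inE => /and3P[].
      by rewrite disjoints1 !inE eqxx.
    by rewrite -setI_eq0 set0I.
  - by move=> t1 t2; rewrite !mem_enum; exact: facets_disjoint_stars.
transitivity (expect p (faces n d)
   (fun S => \sum_(t : {set 'I_n} | #|t| == d) (2 <= #|star t :&: S|)%:R)).
  apply: eq_expect => S _; rewrite -natr_sum; congr (_%:R).
  rewrite -sum1_card (eq_bigl _ _ (fun t => in_set _ _)) big_mkcondr.
  by apply: eq_bigr => t _; case: (_ <= _)%N.
rewrite expect_sum; have -> : 'C(n, d) = #|[set t : {set 'I_n} | #|t| == d]|.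
  by rewrite card_draws card_ord.
rewrite mulr_natl -sumr_const; apply: eq_big => [t|t /eqP ct].
  by rewrite inE.
rewrite expect_ge2_cardI; last by apply/subsetP => s; rewrite inE => /andP[].
by rewrite card_star // subnS.
Qed.

End Core.

(** * The function [g] and the limits as n grows *)

Local Open Scope classical_set_scope.
Local Open Scope ring_scope.

Lemma continuous_g (R : realType) (d : nat) : continuous (@g R d).
Proof.
move=> x; rewrite /g.
have ce : {for x, continuous (fun y : R => expR (- y))}.
  apply: (continuous_comp (f := fun y : R => - y)); first exact: opp_continuous.
  exact: continuous_expR.
apply: cvgD; apply: cvgM => //.
- by apply: cvgM; [exact: cvg_cst|apply: cvgD; [exact: cvg_id|exact: cvg_cst]].
- apply: (@cvg_comp _ _ _ (fun y : R => 1 - expR (- y)) (fun z => z ^+ d.+1) _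
    (nbhs (1 - expR (- x)))); last exact: exprn_continuous.
  by apply: cvgB => //; exact: cvg_cst.
Qed.

(** If [g d c] were at most d+1, then, [g d] being at least d+1 at some [M >= c], the intermediate
    value theorem would give a root in [[c, M]], beyond [cd]. *)
Lemma g_gt (R : realType) (d : nat) (cd c : R) : 0 < cd ->
  (forall x : R, 0 < x -> g d x = d.+1%:R -> x = cd) -> cd < c ->
  d.+1%:R < g d c.
Proof.
move=> cd0 uniq cdc; rewrite ltNge; apply/negP => gc.
have c0 : 0 < c by exact: lt_trans cdc.
(* Large enough that [expR (- M) <= 2^-1] and that [M / 2 ^+ d.+1] is at least d+1; the second
   summand of [g d M] then suffices. *)
pose M : R := c + d.+1%:R * 2 ^+ d.+1 + 1.
have P0 : 0 < d.+1%:R * 2 ^+ d.+1 :> R by rewrite mulr_gt0 ?exprn_gt0 ?ltr0n.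
have M1 : 1 <= M by rewrite /M; lra.
have cM : c <= M by rewrite /M; lra.
have eM : expR (- M) <= 2^-1.
  rewrite expRN lef_pV2 ?posrE ?expR_gt0 //; have := expR_ge1Dx M; lra.
have gM : d.+1%:R <= g d M.
  rewrite /g; apply: (@le_trans _ _ (M * 2^-1 ^+ d.+1)).
    rewrite exprVn ler_pdivlMr ?exprn_gt0 // /M; lra.
  apply: ler_wpDl.
    by rewrite !mulr_ge0 ?expR_ge0 ?ler0n //; lra.
  apply: ler_wpM2l; first lra.
  by apply: lerXn2r; rewrite ?nnegrE; lra.
have [||x /andP[cx xM] gx] := @IVT R (g d) c M d.+1%:R cM.
- by apply: continuous_subspaceT => x; exact: continuous_g.
- by rewrite (min_idPl _) ?(max_idPr _) ?gc ?gM //; exact: le_trans gM.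
have cx' : c <= x by [].
have := uniq x (lt_le_trans c0 cx') gx; move: cx'; lra.
Qed.

(** Both bounds come from [1 + x <= expR x]: the upper one at [x = - p], the lower one at
    [x = p / (1 - p)], where [1 + x] is the inverse of [1 - p]. *)
Lemma le_powN_expR (R : realType) (p : R) (m : nat) : 0 <= p < 1 ->
  expR (- (p * m%:R / (1 - p))) <= (1 - p) ^+ m <= expR (- (p * m%:R)).
Proof.
case/andP => p0 p1; have q0 : 0 < 1 - p by lra.
have -> : - (p * m%:R / (1 - p)) = m%:R * (- (p / (1 - p))) by ring.
have -> : - (p * m%:R) = m%:R * (- p) by ring.
rewrite !expRM_natl; apply/andP; split; apply: lerXn2r; rewrite ?nnegrE ?expR_ge0 ?(ltW q0) //.
  rewrite expRN -[leRHS]invrK lef_pV2 ?posrE ?invr_gt0 ?expR_gt0 //.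
  apply: le_trans (expR_ge1Dx _); rewrite le_eqVlt; apply/orP; left; apply/eqP.
  by field; rewrite lt0r_neq0.
exact: expR_ge1Dx.
Qed.

Lemma cvg_powN_expR (R : realType) (c : R) (p : nat -> R) (m : nat -> nat) :
  (forall n, 0 <= p n) -> p @ \oo --> (0 : R) ->
  (fun n => p n * (m n)%:R) @ \oo --> c ->
  (fun n => (1 - p n) ^+ m n) @ \oo --> expR (- c).
Proof.
move=> p0 cp cpm.
apply: (@squeeze_cvgr _ _ _ _ (fun n => expR (- (p n * (m n)%:R / (1 - p n))))
   (fun n => expR (- (p n * (m n)%:R)))).
- near=> n; apply: le_powN_expR; rewrite p0 /=.
  by near: n; apply: (cvgr_lt _ cp); exact: ltr01.
- apply: (@cvg_comp _ _ _ (fun n => - (p n * (m n)%:R / (1 - p n))) expR _ (nbhs (- c)));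
    last exact: continuous_expR.
  apply: cvgN; rewrite -[X in _ --> X]divr1; apply: cvgM => //.
  apply: cvgV; first exact: oner_neq0.
  by rewrite -[X in _ --> X]subr0; apply: cvgB => //; exact: cvg_cst.
- apply: (@cvg_comp _ _ _ (fun n => - (p n * (m n)%:R)) expR _ (nbhs (- c)));
    [exact: cvgN|exact: continuous_expR].
Unshelve. all: by end_near.
Qed.

Lemma cvg_divn0 (R : realType) (c : R) : (fun n : nat => c / n%:R) @ \oo --> (0 : R).
Proof.
rewrite -(mulr0 c); apply: cvgM; first exact: cvg_cst.
apply/gtr0_cvgV0; last exact: cvgr_idn.
by near=> n; rewrite ltr0n; near: n; exact: nbhs_infty_gt.
Unshelve. all: by end_near.
Qed.

Lemma cvg_divn_sub (R : realType) (c : R) (k : nat) :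
  (fun n : nat => c / n%:R * (n - k)%:R) @ \oo --> c.
Proof.
(* The two sequences agree once [k < n], where the truncated subtraction is exact and [n%:R] is
   invertible. *)
suff: (fun n : nat => c - c / n%:R * k%:R) @ \oo --> c.
  apply: cvg_trans; apply: near_eq_cvg; near=> n.
  have kn : (k < n)%N by near: n; exact: nbhs_infty_gt.
  have n0 : n%:R != 0 :> R by rewrite pnatr_eq0; lia.
  rewrite natrB ?(ltnW kn) // mulrBr; congr (_ - _); by rewrite divfK.
rewrite -[X in _ --> X](subr0 c); apply: cvgB; first exact: cvg_cst.
rewrite -(mul0r k%:R); apply: cvgM; [exact: cvg_divn0|exact: cvg_cst].
Unshelve. all: by end_near.
Qed.

(** The sequence is the expected excess divided by ['C(n, d)], after writing ['C(n, d.+1)] as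
    ['C(n, d)] times (n-d)/(d+1). *)
Lemma cvg_excess (R : realType) (d : nat) (c : R) : 0 < c ->
  (fun n : nat => c / n%:R * (n - d)%:R / d.+1%:R * (1 - (1 - c / n%:R) ^+ (n - d.+1)) ^+ d.+1
     - (1 - (1 - c / n%:R) ^+ (n - d)
         - (n - d)%:R * (c / n%:R * (1 - c / n%:R) ^+ (n - d.+1)))) @ \oo -->
  (g d c - d.+1%:R) / d.+1%:R.
Proof.
move=> c0.
have cq k : (fun n : nat => (1 - c / n%:R) ^+ (n - k)) @ \oo --> expR (- c).
  apply: cvg_powN_expR; [|exact: cvg_divn0|exact: cvg_divn_sub].
  by move=> n; rewrite divr_ge0 ?(ltW c0) ?ler0n.
have -> : (g d c - d.+1%:R) / d.+1%:R =
   c / d.+1%:R * (1 - expR (- c)) ^+ d.+1 - (1 - expR (- c) - c * expR (- c)).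
  by rewrite /g; field; rewrite addrC natr1 pnatr_eq0.
apply: cvgB; [apply: cvgM|apply: cvgB].
- by apply: cvgM; [exact: cvg_divn_sub|exact: cvg_cst].
- apply: (@cvg_comp _ _ _ (fun n : nat => 1 - (1 - c / n%:R) ^+ (n - d.+1))
    (fun z => z ^+ d.+1) _ (nbhs (1 - expR (- c)))); last exact: exprn_continuous.
  by apply: cvgB; [exact: cvg_cst|exact: cq].
- by apply: cvgB; [exact: cvg_cst|exact: cq].
- under eq_fun do rewrite mulrA [_%:R * _]mulrC.
  by apply: cvgM; [exact: cvg_divn_sub|exact: cq].
Qed.

(** * Second moment bound on the probability, and conclusion *)

Lemma prob_Hd_nonzero_le1 (F : fieldType) (R : realType) (d n : nat) (p : R) :
  0 <= p <= 1 -> prob_Hd_nonzero F d n p <= 1.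
Proof.
move=> p01; rewrite -[leRHS](expect_cst p (faces n d)).
by apply: le_expect => // S _; case: ifP.
Qed.

(** Vanishing homology forces the excess to be at most 0. Chebyshev bounds the probability of that,
    with the variance controlled by the Lipschitz constant d+2. *)
Lemma prob_Hd_nonzero_ge (F : fieldType) (R : realType) (d n : nat) (p : R) :
  0 <= p <= 1 ->
  let m := expect p (faces n d) (fun S => #|core d S|%:R - #|heavy d S|%:R) in
  0 < m ->
  1 - p * d.+2%:R ^+ 2 * 'C(n, d.+1)%:R / m ^+ 2 <= prob_Hd_nonzero F d n p.
Proof.
move=> p01 m m0.
set X := fun S : {set {set 'I_n}} => #|core d S|%:R - #|heavy d S|%:R : R.
apply: (@le_trans _ _ (expect p (faces n d) (fun S => 1 - (X S <= 0)%R%:R))).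
  rewrite expectB expect_cst lerD2l lerN2.
  apply: le_trans (expect_chebyshev p01 m0) _.
  apply: ler_wpM2r; first by rewrite invr_ge0 exprn_ge0 // ltW.
  have <- : #|faces n d| = 'C(n, d.+1) by rewrite card_draws card_ord.
  apply: expect_var_le => // x S xd Sd xS; exact: core_excess_lipschitz.
apply: le_expect => // S Sd; case: asboolP => H; first by rewrite lerBlDr lerDl ler0n.
have -> : X S <= 0; last by rewrite subrr.
rewrite subr_le0 ler_nat leqNgt; apply/negP => /(core_homology F Sd); exact: H.
Qed.

(** A crude linear bound, proved by Pascal's rule; it is enough to make the error term O(1/n). *)
Lemma leq_sub_bin n d : (0 < d)%N -> (n - d <= 'C(n, d))%N.
Proof.
case: d => // d _; elim: n => // n IH; rewrite binS subSS.
have [nd|dn] := leqP n d; first lia.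
have : (0 < 'C(n, d))%N by rewrite bin_gt0 ltnW.
lia.
Qed.

Theorem theorem2 (R : realType) (F : fieldType) (d : nat) (cd c : R) :
  (2 <= d)%N ->
  0 < cd -> g d cd = d.+1%:R ->
  (forall x : R, 0 < x -> g d x = d.+1%:R -> x = cd) ->
  cd < c ->
  (fun n : nat => prob_Hd_nonzero F d n (c / n%:R)) @ \oo --> (1 : R).
Proof.
move=> d2 cd0 _ cd_uniq cdc; have c0 : 0 < c := lt_trans cd0 cdc.
have gc := g_gt cd0 cd_uniq cdc.
have d1 : 0 < d.+1%:R :> R by rewrite ltr0n.
pose l : R := (g d c - d.+1%:R) / d.+1%:R.
have l0 : 0 < l by rewrite divr_gt0 // subr_gt0.
have l20 : 0 < l / 2 by rewrite divr_gt0.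
have l2l : l / 2 < l by rewrite ltr_pdivrMr // ltr_pMr // ltr1n.
(* Variance factor over squared mean, both per (d-1)-face, with the mean at least [l / 2]
   eventually; the factor 2 pays for ['C(n, d) >= n / 2]. *)
pose K : R := 2 * c * d.+2%:R ^+ 2 / (l / 2) ^+ 2.
have evl := cvgr_gt _ (@cvg_excess R d c c0) _ l2l.
apply: (@squeeze_cvgr _ _ _ _ (fun n : nat => 1 - K / n%:R) (fun=> 1)).
- near=> n.
  (* Ensures [n - d >= n / 2], hence the same lower bound for ['C(n, d)]. *)
  have nd : (2 * d < n)%N by near: n; exact: nbhs_infty_gt.
  have dn : (d <= n)%N := leq_trans (leq_pmull d (ltn0Sn 1)) (ltnW nd).
  have cn : c <= n%:R by near: n; exact: nbhs_infty_ger.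
  have n0 : 0 < n%:R :> R by rewrite ltr0n (leq_ltn_trans _ nd).
  set p := c / n%:R.
  have p0 : 0 <= p by rewrite divr_ge0 ?ltW.
  have p01 : 0 <= p <= 1 by rewrite p0 /= ler_pdivrMr // mul1r.
  rewrite prob_Hd_nonzero_le1 // andbT.
  set e := p * (n - d)%:R / d.+1%:R * (1 - (1 - p) ^+ (n - d.+1)) ^+ d.+1
     - (1 - (1 - p) ^+ (n - d) - (n - d)%:R * (p * (1 - p) ^+ (n - d.+1))).
  have le : l / 2 < e.
    by rewrite /e /p; near: n; exact: evl.
  have binE : 'C(n, d.+1)%:R = 'C(n, d)%:R * (n - d)%:R / d.+1%:R :> R.
    by apply: (canRL (mulfK (lt0r_neq0 d1))); rewrite -!natrM mulnC mul_bin_left mulnC.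
  have mE : expect p (faces n d) (fun S => #|core d S|%:R - #|heavy d S|%:R) =
      'C(n, d)%:R * e.
    by rewrite expect_core_excess binE /e; ring.
  have C0 : 0 < 'C(n, d)%:R :> R by rewrite ltr0n bin_gt0.
  have e0 : 0 < e := lt_trans l20 le.
  apply: le_trans (prob_Hd_nonzero_ge F p01 _); rewrite mE; last exact: mulr_gt0.
  rewrite lerD2l lerN2 binE.
  (* One factor ['C(n, d)] cancels: the variance is linear in it and the squared mean quadratic,
     which leaves the decay [1 / 'C(n, d)]. *)
  have -> : p * d.+2%:R ^+ 2 * ('C(n, d)%:R * (n - d)%:R / d.+1%:R) / ('C(n, d)%:R * e) ^+ 2
     = p * (n - d)%:R / d.+1%:R * d.+2%:R ^+ 2 / e ^+ 2 / 'C(n, d)%:R.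
    by field; rewrite (lt0r_neq0 e0) (lt0r_neq0 C0) addrC natr1 (lt0r_neq0 d1).
  have -> : K / n%:R = c * d.+2%:R ^+ 2 / (l / 2) ^+ 2 / (n%:R / 2).
    by rewrite /K; field; rewrite (lt0r_neq0 n0) (lt0r_neq0 l0).
  apply: ler_pM.
  + by rewrite !mulr_ge0 ?invr_ge0 ?exprn_ge0 ?ler0n // ltW.
  + by rewrite invr_ge0 ler0n.
  + apply: ler_pM.
    * by rewrite !mulr_ge0 ?invr_ge0 ?exprn_ge0 ?ler0n // ltW.
    * by rewrite invr_ge0 exprn_ge0 // ltW.
    * apply: ler_wpM2r; first by rewrite exprn_ge0 ?ler0n.
      rewrite ler_pdivrMr // /p mulrAC ler_pdivrMr // -mulrA ler_wpM2l ?(ltW c0) //.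
      by rewrite -natrM ler_nat (leq_trans (leq_subr _ _)) // leq_pmull.
    * rewrite lef_pV2 ?posrE ?exprn_gt0 //.
      by apply: lerXn2r; rewrite ?nnegrE ltW.
  + rewrite lef_pV2 ?posrE ?divr_gt0 // ler_pdivrMr //.
    rewrite -natrM ler_nat; have := @leq_sub_bin n d; move: d2 nd; clear; lia.
- rewrite -[X in _ --> X]subr0; apply: cvgB; first exact: cvg_cst.
  exact: cvg_divn0.
- exact: cvg_cst.
Unshelve. all: by end_near.
Qed.
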